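(* Let $\mathscr{A}$ be a $C^*$-algebra and let $\delta$ be a densely defined $*$-derivation on $\mathscr{A}$. Assume that there exists a state $\omega$ on $\mathscr{A}$ whose GNS (cyclic) representation $(\pi,H,f)$ is faithful and which satisfies $\omega(\delta(a))=0$ for all $a\in\operatorname{dom}\delta$. Assume also that the set $\mathscr{A}^\infty$ of analytic vectors for $\delta$ is dense in $\mathscr{A}$. Then for every natural number $n\ge 1$, $$\ker\delta^n=\ker\delta.$$
   Context: A densely defined $*$-derivation on $\mathscr{A}$ is a linear map $\delta:\operatorname{dom}\delta\to\mathscr{A}$, where $\operatorname{dom}\delta$ is a norm-dense $*$-subalgebra of $\mathscr{A}$, such that $\delta(ab)=\delta(a)b+a\delta(b)$ and $\delta(a^* )=\delta(a)^*$ for all $a,b\in\operatorname{dom}\delta$. Powers $\delta^n$ have their natural domains (i.e. $a\in\operatorname{dom}\delta^n$ iff $\delta^k(a)\in\operatorname{dom}\delta$ for $k=0,\dots,n-1$), and $\ker\delta^n=\{a\in\operatorname{dom}\delta^n:\delta^n(a)=0\}$. An element $a\in\mathscr{A}$ is an analytic vector for $\delta$ if $a\in\bigcap_{k\in\mathbb{N}}\operatorname{dom}\delta^k$ and there exists $t>0$ such that $\sum_{k=0}^\infty\frac{t^k}{k!}\|\delta^k(a)\|$ converges. *)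

(* Defs.v *)
From HB Require Import structures.
From mathcomp Require Export all_boot all_order all_algebra.
From mathcomp Require Export sesquilinear complex.
From mathcomp Require Export all_classical all_reals all_analysis.
Export Order.TTheory GRing.Theory Num.Theory numFieldNormedType.Exports.

Set Implicit Arguments.
Unset Strict Implicit.
Unset Printing Implicit Defensive.

Global Open Scope classical_set_scope.
Global Open Scope ring_scope.

(* No unit is assumed, and MathComp rings are unital: hence the product is an
   operation of its own and not a ring structure.  The norm `|a| of a complex
   normed module takes its values in R[i]. *)
HB.mixin Record isCStarAlgebra (R : realType) A
    of CompleteNormedModule R[i] A := {
  cmul : A -> A -> A ;
  star : A -> A ;
  cmulA : associative cmul ;
  cmul_linearl : forall b : A, linear (cmul^~ b) ;
  cmul_linearr : forall a : A, linear (cmul a) ;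
  starK : involutive star ;
  star_conj_linear : forall (c : R[i]) (a b : A),
    star (c *: a + b) = Num.conj c *: star a + star b ;
  starM : forall a b : A, star (cmul a b) = cmul (star b) (star a) ;
  norm_cmul : forall a b : A, `|cmul a b| <= `|a| * `|b| ;
  norm_cstar : forall a : A, `|cmul (star a) a| = `|a| ^+ 2
}.

#[short(type="cstarAlgType")]
HB.structure Definition CStarAlgebra (R : realType) :=
  {A of isCStarAlgebra R A & CompleteNormedModule R[i] A}.

(* Inner products are linear in the first variable. *)
HB.mixin Record isHilbert (R : realType) H of CompleteNormedModule R[i] H := {
  inner : {dot H for @Num.conj R[i]} ;
  norm_inner : forall x : H, `|x| ^+ 2 = inner x x
}.

#[short(type="hilbertType")]
HB.structure Definition Hilbert (R : realType) :=
  {H of isHilbert R H & CompleteNormedModule R[i] H}.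

Definition rnorm (R : realType) (V : normedModType R[i]) (x : V) : R :=
  complex.Re `|x|.

(* The supremum in the second clause is the norm of the functional. *)
Definition is_state (R : realType) (A : cstarAlgType R)
    (omega : {scalar A}) : Prop :=
  (forall a : A, 0 <= omega (cmul (star a) a)) /\
  ereal_sup [set (complex.Re `|omega a|)%:E | a in [set a : A | `|a| <= 1]]
    = 1%:E.

Record star_rep (R : realType) (A : cstarAlgType R) (H : hilbertType R) :=
  StarRep {
  rep :> A -> {linear H -> H} ;
  rep_continuous : forall a, continuous (rep a) ;
  rep_linear : forall (c : R[i]) (a b : A) (x : H),
    rep (c *: a + b) x = c *: rep a x + rep b x ;
  rep_mul : forall (a b : A) (x : H), rep (cmul a b) x = rep a (rep b x) ;
  rep_star : forall (a : A) (x y : H),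
    inner (rep (star a) x) y = inner x (rep a y)
}.

Definition faithful_rep (R : realType) (A : cstarAlgType R)
    (H : hilbertType R) (pi : star_rep A H) : Prop :=
  forall a b : A, (forall x : H, pi a x = pi b x) -> a = b.

(* (pi, H, f) is the GNS triple of omega; these two conditions determine it up
   to unitary equivalence. *)
Definition is_GNS (R : realType) (A : cstarAlgType R) (omega : {scalar A})
    (H : hilbertType R) (pi : star_rep A H) (f : H) : Prop :=
  dense [set pi a f | a in [set: A]] /\
  (forall a : A, omega a = inner (pi a f) f).

(* The derivation is carried by a total function whose values outside the
   domain are unconstrained; nothing below depends on them. *)
Record star_derivation (R : realType) (A : cstarAlgType R) := StarDerivation {
  sdom : set A ;
  sder :> A -> A ;
  sdom_dense : dense sdom ;
  sdom0 : sdom 0 ;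
  sdom_lin : forall (c : R[i]) (a b : A),
    sdom a -> sdom b -> sdom (c *: a + b) ;
  sdom_mul : forall a b : A, sdom a -> sdom b -> sdom (cmul a b) ;
  sdom_star : forall a : A, sdom a -> sdom (star a) ;
  sder_lin : forall (c : R[i]) (a b : A),
    sdom a -> sdom b -> sder (c *: a + b) = c *: sder a + sder b ;
  sder_mul : forall a b : A, sdom a -> sdom b ->
    sder (cmul a b) = cmul (sder a) b + cmul a (sder b) ;
  sder_star : forall a : A, sdom a -> sder (star a) = star (sder a)
}.

Section Powers.
Context (R : realType) (A : cstarAlgType R) (delta : star_derivation A).

Definition dom_pow (n : nat) : set A :=
  [set a | forall k, (k < n)%N -> sdom delta (iter k delta a)].

Definition ker_pow (n : nat) : set A :=
  [set a | dom_pow n a /\ iter n delta a = 0].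

Definition ker : set A := [set a | sdom delta a /\ delta a = 0].

Definition analytic_vectors : set A :=
  [set a | (forall k, dom_pow k a) /\
    exists2 t : R, 0 < t &
      cvgn (series (fun k => t ^+ k / k`!%:R * rnorm (iter k delta a)))].

End Powers.

(* Main.v *)
Require Import Defs.
From mathcomp Require Import ring.

(** It suffices to show that [delta (delta a) = 0] implies [e := delta a = 0].
    For an analytic vector b put v_k = pi(delta^k b) f.  As omega vanishes on
    the range of delta, the array <v_j, v_k> is killed by the Leibniz operator
    s |-> s(j+1,k) + s(j,k+1), whereas the array <pi(a) v_j, pi(e) v_k> is sent
    to -<pi(e) v_j, pi(e) v_k>, which is killed in turn.  The flow
    w_j = sum_i t^i/i! v_(i+j), defined for small t, therefore preserves the
    norms of the v_j, and hence the radius of convergence, so that it can be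
    iterated for ever with the same t.  Under the flow <pi(a) v_0, pi(e) v_0>
    grows linearly with slope -|pi(e) v_0|^2, yet it is bounded by a multiple
    of |v_0|^2.  So pi(e) pi(b) f = 0; by density pi(e) = 0, and e = 0 because
    pi is faithful. *)

Set Implicit Arguments.
Unset Strict Implicit.
Unset Printing Implicit Defensive.

(** * Real-valued norms on complex normed spaces *)

Section RealNorm.
Context {R : realType}.

(* [rnorm] on normed Z-modules, so that it also applies to scalars of [R[i]]. *)
Definition rnm {V : normedZmodType R[i]} (x : V) : R := complex.Re `|x|.

Section ZmodNorm.
Context {V : normedZmodType R[i]}.
Implicit Types x y : V.

Lemma rnmE x : `|x| = (rnm x)%:C%C.
Proof. by rewrite /rnm [LHS]complexE (ger0_Im (normr_ge0 x)) mulr0 addr0. Qed.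

Lemma rnm_ge0 x : 0 <= rnm x.
Proof. by rewrite -lecR -rnmE normr_ge0. Qed.

Lemma rnmD x y : rnm (x + y) <= rnm x + rnm y.
Proof. by rewrite -lecR -rnmE rmorphD /= -!rnmE ler_normD. Qed.

Lemma rnmN x : rnm (- x) = rnm x.
Proof. by rewrite /rnm normrN. Qed.

Lemma rnm0 : rnm (0 : V) = 0.
Proof. by rewrite /rnm normr0. Qed.

Lemma rnm0_eq0 x : rnm x = 0 -> x = 0.
Proof. by move=> x0; apply/normr0_eq0; rewrite rnmE x0. Qed.

Lemma rnm_sum (I : Type) (r : seq I) (P : pred I) (F : I -> V) :
  rnm (\sum_(i <- r | P i) F i) <= \sum_(i <- r | P i) rnm (F i).
Proof.
elim/big_rec2: _ => [|i x y _ le]; first by rewrite rnm0.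
by apply: le_trans (rnmD _ _) _; rewrite lerD2l.
Qed.

End ZmodNorm.

Lemma rnmM (c d : R[i]) : rnm (c * d) = rnm c * rnm d.
Proof. by apply: (@complexI R); rewrite rmorphM /= -!rnmE normrM. Qed.

Lemma rnmZ {V : normedModType R[i]} (c : R[i]) (x : V) :
  rnm (c *: x) = rnm c * rnm x.
Proof. by apply: (@complexI R); rewrite rmorphM /= -!rnmE normrZ. Qed.

Lemma rnm_real (r : R) : rnm (r%:C%C) = `|r|.
Proof. by rewrite /rnm normc_def /= expr0n addr0 sqrtr_sqr. Qed.

Lemma conj_real (r : R) : Num.conj (r%:C%C) = r%:C%C :> R[i].
Proof. by apply: conj_Creal; rewrite complex_real. Qed.

End RealNorm.

(** * Inner products and the Cauchy-Schwarz inequality *)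

Section Inner.
Context {R : realType} {H : hilbertType R}.
Implicit Types x y z : H.

Lemma innerDl x y z : inner (x + y) z = inner x z + inner y z.
Proof. exact: linearDl. Qed.

Lemma innerDr x y z : inner x (y + z) = inner x y + inner x z.
Proof. exact: linearDr. Qed.

Lemma innerZl (c : R[i]) x y : inner (c *: x) y = c * inner x y.
Proof. exact: linearZl_LR. Qed.

Lemma innerZr (c : R[i]) x y : inner x (c *: y) = Num.conj c * inner x y.
Proof. exact: linearZr_LR. Qed.

Lemma inner_conj x y : inner x y = Num.conj (inner y x).
Proof. by rewrite hermC expr0 mul1r. Qed.

Lemma innerBl x y z : inner (x - y) z = inner x z - inner y z.
Proof. by rewrite -scaleN1r innerDl innerZl mulN1r. Qed.

Lemma innerBr x y z : inner x (y - z) = inner x y - inner x z.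
Proof. by rewrite -scaleN1r innerDr innerZr rmorphN1 mulN1r. Qed.

Lemma inner_rnm x : inner x x = (rnm x ^+ 2)%:C%C.
Proof. by rewrite -norm_inner rnmE rmorphXn. Qed.

(** The square norm of [inner y y *: x - inner x y *: y] is nonnegative; expanding it and cancelling
    [rnm y ^+ 2] gives the squared inequality. *)
Lemma inner_le x y : rnm (inner x y) <= rnm x * rnm y.
Proof.
have [y0|yn0] := eqVneq (rnm y) 0.
  by rewrite (rnm0_eq0 y0) -(scale0r (0 : H)) innerZr rmorph0 mul0r rnmZ !rnm0 mul0r mulr0.
have ygt0 : 0 < rnm y by rewrite lt_neqAle eq_sym yn0 rnm_ge0.
have key : 0 <= (rnm y ^+ 2) * (rnm x ^+ 2 * rnm y ^+ 2 - rnm (inner x y) ^+ 2).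
  rewrite -lecR.
  have <- : inner (inner y y *: x - inner x y *: y)
                  (inner y y *: x - inner x y *: y) =
      (rnm y ^+ 2 * (rnm x ^+ 2 * rnm y ^+ 2 - rnm (inner x y) ^+ 2))%:C%C.
    rewrite !(innerBl, innerBr, innerZl, innerZr).
    have -> : (rnm y ^+ 2 * (rnm x ^+ 2 * rnm y ^+ 2 - rnm (inner x y) ^+ 2))%:C%C
      = inner y y * (inner x x * inner y y - inner x y * Num.conj (inner x y))
          :> R[i].
      rewrite -normCK rnmE !inner_rnm.
      by rewrite !(rmorphM, rmorphB, rmorphXn).
    rewrite -(inner_conj y y) -(inner_conj y x).
    ring.
  by rewrite inner_rnm lecR sqr_ge0.
rewrite pmulr_rge0 ?exprn_gt0// subr_ge0 -exprMn in key.
by rewrite -(@ler_pXn2r _ 2)// nnegrE ?mulr_ge0 ?rnm_ge0.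
Qed.

Lemma inner_eq0 x : inner x x = 0 -> x = 0.
Proof.
rewrite inner_rnm => /(congr1 (@complex.Re R)) /= /eqP.
by rewrite expf_eq0 /= => /eqP /rnm0_eq0.
Qed.

Lemma inner_suml (I : Type) (r : seq I) (P : pred I) (F : I -> H) y :
  inner (\sum_(i <- r | P i) F i) y = \sum_(i <- r | P i) inner (F i) y.
Proof.
elim/big_rec2: _ => [|i u v _ <-]; last by rewrite innerDl.
by rewrite -(subrr (0 : H)) innerBl subrr.
Qed.

Lemma inner_sumr (I : Type) (r : seq I) (P : pred I) (F : I -> H) x :
  inner x (\sum_(i <- r | P i) F i) = \sum_(i <- r | P i) inner x (F i).
Proof.
elim/big_rec2: _ => [|i u v _ <-]; last by rewrite innerDr.
by rewrite -(subrr (0 : H)) innerBr subrr.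
Qed.

End Inner.

(** * Powers of the Leibniz operator on double arrays *)

Section Leibniz.
Context {V : zmodType}.
Implicit Types s F : nat -> nat -> V.

Definition leibniz s : nat -> nat -> V := fun j k => s j.+1 k + s j k.+1.

(** The binomial theorem for the two commuting index shifts; the induction step is Pascal's rule. *)
Lemma iter_leibniz n s j k : iter n leibniz s j k =
  \sum_(i < n.+1) s (i + j)%N (n - i + k)%N *+ 'C(n, i).
Proof.
elim: n j k => [|n IH] j k; first by rewrite big_ord1.
rewrite iterS /leibniz !IH [RHS]big_ord_recl /= bin0 /bump /=.
under [X in _ = _ + X]eq_bigr => i _ do rewrite add1n subSS binS mulrnDr.
rewrite big_split /= [RHS]addrA [RHS]addrC; congr (_ + _).
  by apply: eq_bigr => i _; rewrite addSnnS.
rewrite big_ord_recl big_ord_recr /= bin0 bin_small// mulr0n addr0 !subn0.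
rewrite addSnnS; congr (_ + _); apply: eq_bigr => i _.
by rewrite /bump /= add1n addnS -addSn -subSn// subSS.
Qed.

Lemma sum_triangle F m : \sum_(i < m) \sum_(l < m - i) F i l =
  \sum_(n < m) \sum_(i < n.+1) F i (n - i)%N.
Proof.
elim: m => [|m IH]; first by rewrite !big_ord0.
rewrite [RHS]big_ord_recr -IH /=.
under eq_bigr => i _ do rewrite subSn ?leq_ord// big_ord_recr.
rewrite big_split /=; congr (_ + _).
by rewrite big_ord_recr /= subnn big_ord0 addr0.
Qed.

End Leibniz.

(** * Exponential coefficients and geometric error bounds *)

Section Estimates.
Context {R : realType}.

Definition expc (t : R) (i : nat) : R := t ^+ i / i`!%:R.

Lemma expc_bin (t : R) n i : (i <= n)%N ->
  expc t i * expc t (n - i) = expc t n *+ 'C(n, i).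
Proof.
move=> lein; rewrite /expc mulrACA -exprD subnKC// -mulrnAr; congr (_ * _).
rewrite -(bin_fact lein) !natrM !invfM -mulr_natr.
have F k : (k`!%:R : R) != 0 by rewrite pnatr_eq0 -lt0n fact_gt0.
have B : ('C(n, i)%:R : R) != 0 by rewrite pnatr_eq0 -lt0n bin_gt0.
by field; rewrite !F B.
Qed.

(** A product of two exponential series, cut off by total degree, regroups along antidiagonals into
    the truncated exponential of t times [leibniz]. *)
Lemma sum_triangle_expc (t : R) (s : nat -> nat -> R[i]) m j k :
  \sum_(i < m) \sum_(l < m - i)
     (expc t i)%:C%C * (expc t l)%:C%C * s (i + j)%N (l + k)%N =
  \sum_(n < m) (expc t n)%:C%C * iter n leibniz s j k.
Proof.
rewrite (sum_triangle (fun i l =>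
  (expc t i)%:C%C * (expc t l)%:C%C * s (i + j)%N (l + k)%N)).
apply: eq_bigr => n _; rewrite iter_leibniz mulr_sumr; apply: eq_bigr => i _.
by rewrite -rmorphM /= expc_bin ?leq_ord// rmorphMn /= mulrnAl mulrnAr.
Qed.

(** The bound is asked only from m = 2 on because the flow compares with partial sums that must
    contain the terms of degree 0 and 1. *)
Lemma half_pow_eq0 (x K : R) : 0 <= x ->
  (forall m, (2 <= m)%N -> x <= K * 2^-1 ^+ m) -> x = 0.
Proof.
move=> x0 xK; apply/eqP; rewrite eq_le x0 andbT leNgt; apply/negP => xgt0.
have Kx : 0 <= `|K| / x by rewrite divr_ge0.
set m := (Num.Def.archi_bound (`|K| / x)).+2.
have mK : `|K| / x < m%:R.
  by apply: lt_le_trans (archi_boundP Kx) _; rewrite ler_nat leqW.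
have := xK m isT; rewrite leNgt => /negP; apply.
rewrite exprVn ltr_pdivrMr ?exprn_gt0//.
apply: le_lt_trans (ler_norm K) _.
rewrite ltr_pdivrMr// mulrC in mK.
apply: lt_le_trans mK _; rewrite ler_pM2l// -natrX ler_nat.
exact/ltnW/ltn_expl.
Qed.

Lemma square_sum_eighth m : (m * m)%:R * 8^-1 ^+ m <= 2^-1 ^+ m :> R.
Proof.
have -> : 8^-1 = 4^-1 * 2^-1 :> R by field.
rewrite exprMn mulrA ler_piMl ?exprn_ge0// exprVn ler_pdivrMr ?exprn_gt0//.
rewrite mul1r -natrX ler_nat -[4%N]/(2 * 2)%N expnMn.
by rewrite leq_mul// ltnW// ltn_expl.
Qed.

(** Only terms with i + l >= m survive, each at most [G * 8^-1 ^+ m]; their number is absorbed by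
    weakening 8 to 2. *)
Lemma square_triangle_error (F : nat -> nat -> R[i]) (G : R) m :
  (forall i l, rnm (F i l) <= G * 8^-1 ^+ (i + l)) ->
  rnm (\sum_(i < m) \sum_(l < m) F i l - \sum_(i < m) \sum_(l < m - i) F i l)
    <= G * 2^-1 ^+ m.
Proof.
move=> FG; have G0 : 0 <= G.
  by have := le_trans (rnm_ge0 _) (FG 0%N 0%N); rewrite expr0 mulr1.
rewrite -sumrB; apply: le_trans (rnm_sum _ _ _) _.
apply: le_trans (_ : \sum_(i < m) \sum_(l < m) (G * 8^-1 ^+ m) <= _); last first.
  rewrite !sumr_const !card_ord -mulrnA -[_ *+ (m * m)]mulr_natr -mulrA.
  by rewrite ler_wpM2l// mulrC square_sum_eighth.
apply: ler_sum => i _; rewrite [X in _ - X](big_ord_widen m (F i)) ?leq_subr//.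
rewrite (bigID (fun l : 'I_m => (l < m - i)%N)) /= addrAC subrr add0r.
apply: le_trans (rnm_sum _ _ _) _.
rewrite [leRHS](bigID (fun l : 'I_m => (l < m - i)%N)) /= addrC.
rewrite -[leLHS]addr0 lerD ?sumr_ge0// => [|l _]; last first.
  by rewrite mulr_ge0 ?exprn_ge0.
apply: ler_sum => l; rewrite -leqNgt leq_subLR => le.
apply: le_trans (FG _ _) _; rewrite ler_wpM2l//.
by rewrite ler_wiXn2l ?invr_ge0// invf_le1// ler1n.
Qed.

Lemma exists_half_pow_lt (K e : R) : 0 < e -> exists N, K * 2^-1 ^+ N < e.
Proof.
move=> e0; apply: contrapT => /forallNP NK.
have /half_pow_eq0 e00 m : (2 <= m)%N -> e <= K * 2^-1 ^+ m.
  by move=> _; rewrite leNgt; apply/negP/NK.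
by have := e0; rewrite (e00 (ltW e0)) ltxx.
Qed.

(** Completeness gives the sum; the explicit tail bound lets the flow be compared with its partial
    sums. *)
Lemma geometric_series_limit (H : completeNormedModType R[i]) (u : nat -> H)
    (G : R) : (forall m, rnm (u m) <= G * 2^-1 ^+ m) ->
  exists w, forall m, rnm (w - \sum_(i < m) u i) <= 2 * G * 2^-1 ^+ m.
Proof.
move=> uG; have G0 : 0 <= G.
  by have := le_trans (rnm_ge0 _) (uG 0%N); rewrite expr0 mulr1.
have uB m n : (m <= n)%N ->
    rnm (\sum_(m <= i < n) u i) <= 2 * G * 2^-1 ^+ m.
  move=> /subnKC <-; apply: le_trans (rnm_sum _ _ _) _.
  (* The exact geometric tail is kept, since the weaker bound would not pass through the induction
     on the length. *)
  apply: le_trans (_ : 2 * G * (2^-1 ^+ m - 2^-1 ^+ (m + (n - m))) <= _);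
    last by rewrite ler_wpM2l ?mulr_ge0// gerBl exprn_ge0.
  elim: (n - m)%N => [|d IH]; first by rewrite addn0 big_geq// subrr mulr0.
  rewrite addnS big_nat_recr ?leq_addr//=.
  apply: le_trans (lerD IH (uG _)) _; rewrite exprS.
  set b := 2^-1 ^+ (m + d); have -> : G * b = 2 * G * (b - 2^-1 * b) by field.
  by rewrite -mulrDr addrA subrK.
have uc : cvgn (series u).
  apply/cauchy_cvgP/cauchy_seriesP => e e0.
  have eE : e = (complex.Re e)%:C%C.
    by rewrite [LHS]complexE (ger0_Im (ltW e0)) mulr0 addr0.
  have := e0; rewrite eE ltcR => /(exists_half_pow_lt (2 * G))[N GN].
  exists ([set n | (N <= n)%N], [set n | (N <= n)%N]).
    by split; exists N.
  move=> [m n] /= [Nm _].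
  have [mn|/ltnW mn] := leqP m n; last first.
    by rewrite big_geq// normr0 -eE.
  rewrite rnmE ltcR; apply: le_lt_trans (uB _ _ mn) _.
  apply: le_lt_trans GN; rewrite ler_wpM2l ?mulr_ge0//.
  by rewrite ler_wiXn2l ?invr_ge0// invf_le1// ler1n.
exists (limn (series u)) => m; apply/ler_addgt0Pr => e e0.
have /cvgrPdist_lt/(_ e%:C%C) := uc; rewrite ltcR => /(_ e0)[N _ NX].
(* This index is both close to the limit and beyond m, so that [uB] covers the rest. *)
have /= := NX (maxn N m) (leq_maxl N m).
rewrite rnmE ltcR => /ltW limX.
rewrite -[_ - _](subrKA (series u (maxn N m))) addrC.
apply: le_trans (rnmD _ _) _; rewrite lerD// seriesEnat/=.
rewrite (big_cat_nat (leq0n m) (leq_maxr N m)) /= big_mkord addrAC subrr add0r.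
exact/uB/leq_maxr.
Qed.

End Estimates.

Lemma bin_le_exp2 n i : ('C(n, i) <= 2 ^ n)%N.
Proof.
elim: n i => [|n IH] [|i]; rewrite ?bin0 ?expn_gt0// binS.
by rewrite expnS mul2n -addnn leq_add.
Qed.

(** In the growth bound of v (i + j) this separates i!, cancelled by the exponential coefficient,
    from j!. *)
Lemma fact_add_le i j : ((i + j)`! <= 2 ^ (i + j) * (i`! * j`!))%N.
Proof.
rewrite -(bin_fact (leq_addr j i)) addKn.
by rewrite leq_mul2r bin_le_exp2 orbT.
Qed.

(** * The flow of a sequence of factorial growth *)

Section Flow.
Context {R : realType} {H : hilbertType R}.
Implicit Types (P Q : {linear H -> H}) (v w : nat -> H).

Definition bounded_op P := exists p : R, forall x, rnm (P x) <= p * rnm x.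

(** The pair of identities controls the norms of the v_k, and a pair of represented elements gives
    the array that grows linearly. *)
Definition form P Q v : nat -> nat -> R[i] :=
  fun j k => inner (P (v j)) (Q (v k)).

Lemma bounded_op_ge0 P : bounded_op P ->
  exists2 p : R, 0 <= p & forall x, rnm (P x) <= p * rnm x.
Proof.
move=> [p Pp]; exists `|p| => // x; apply: le_trans (Pp x) _.
by rewrite ler_wpM2r ?rnm_ge0// ler_norm.
Qed.

Lemma bounded_op_id : bounded_op idfun.
Proof. by exists 1 => x; rewrite mul1r. Qed.

Lemma inner_sub_le (x x' y y' : H) : rnm (inner x y - inner x' y') <=
  rnm (x - x') * rnm y + rnm x' * rnm (y - y').
Proof.
have -> : inner x y - inner x' y' = inner (x - x') y + inner x' (y - y').
  by rewrite innerBl innerBr addrA subrK.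
by apply: le_trans (rnmD _ _) _; rewrite lerD// inner_le.
Qed.

Section Step.
Variables (v : nat -> H) (G rho : R).
Hypothesis rho_gt0 : 0 < rho.
Hypothesis G_ge0 : 0 <= G.
Hypothesis v_growth : forall k, rnm (v k) <= G * k`!%:R * rho ^+ k.

(* As (i + j)! <= 2^(i+j) i! j!, this t makes the i-th term of the flow at most
   g_j 8^-i; the fewer than m^2 terms with i + l >= m of the product of two
   partial sums then add up to O(2^-m). *)
Let t := (16 * rho)^-1.
Let g j := G * j`!%:R * (2 * rho) ^+ j.

Let g_ge0 j : 0 <= g j.
Proof. by rewrite !mulr_ge0// exprn_ge0// mulr_ge0// ltW. Qed.

Let expc_ge0 i : 0 <= expc t i.
Proof. by rewrite divr_ge0// exprn_ge0// invr_ge0 mulr_ge0// ltW. Qed.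

Let u j i : H := (expc t i)%:C%C *: v (i + j)%N.

Let u_le j i : rnm (u j i) <= g j * 8^-1 ^+ i.
Proof.
rewrite /u rnmZ rnm_real ger0_norm//.
apply: le_trans (ler_wpM2l (expc_ge0 i) (v_growth (i + j))) _.
have F n : (n`!%:R : R) != 0 by rewrite pnatr_eq0 -lt0n fact_gt0.
have r0 : rho != 0 by rewrite gt_eqF.
apply: le_trans (_ : expc t i *
   (G * (2 ^ (i + j) * (i`! * j`!))%:R * rho ^+ (i + j)) <= _).
  rewrite ler_wpM2l// ler_wpM2r ?exprn_ge0 ?(ltW rho_gt0)//.
  by rewrite ler_wpM2l// ler_nat fact_add_le.
rewrite le_eqVlt; apply/orP; left; apply/eqP.
have -> : (8^-1 : R) = t * (2 * rho) by rewrite /t; field.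
rewrite /expc /g !natrM natrX !exprMn !exprD.
by field.
Qed.

Let X j m := \sum_(i < m) u j i.

(** The form of w is the exponential of t times [leibniz] applied to the form of v, and it stops
    after the linear term when [leibniz] squares to 0 there. The sequence w is chosen before P and
    Q, so one flow serves all pairs. *)
Lemma flow : exists w, forall P Q, bounded_op P -> bounded_op Q ->
    (forall j k, leibniz (leibniz (form P Q v)) j k = 0) ->
  forall j k, form P Q w j k =
    form P Q v j k + t%:C%C * leibniz (form P Q v) j k.
Proof.
have /choice[w wX] : forall j, exists x : H, forall m,
    rnm (x - X j m) <= 2 * g j * 2^-1 ^+ m.
  move=> j; apply: geometric_series_limit => m; apply: le_trans (u_le j m) _.
  by rewrite ler_wpM2l// lerXn2r ?nnegrE ?invr_ge0// lef_pV2 ?posrE// ler_nat.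
exists w => P Q /bounded_op_ge0[p p0 Pp] /bounded_op_ge0[q q0 Qq] D2 j k.
apply/eqP; rewrite -subr_eq0; apply/eqP/rnm0_eq0.
(* The three summands pay for replacing w j by its partial sum, then w k by its own, and for cutting
   the square down to the triangle. *)
apply: (@half_pow_eq0 _ _ (p * (2 * g j) * (q * rnm (w k)) +
   p * (rnm (w j) + 2 * g j) * (q * (2 * g k)) + p * g j * (q * g k))).
  exact: rnm_ge0.
move=> m m2.
set s := form P Q v.
have iterD n : (2 <= n)%N -> iter n leibniz s j k = 0.
  case: n => [|[|n]]// _; elim: n (j) (k) => [|n IH] j' k'; first exact: D2.
  by rewrite iterS /leibniz !IH addr0.
have triangle : \sum_(i < m) \sum_(l < m - i)
     (expc t i)%:C%C * (expc t l)%:C%C * s (i + j)%N (l + k)%N =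
     s j k + t%:C%C * leibniz s j k.
  rewrite sum_triangle_expc; case: m m2 => [|[|m]]// _.
  rewrite 2!big_ord_recl big1 => [|i _]; last by rewrite iterD ?mulr0.
  by rewrite /= /expc expr0 expr1 !divr1 mul1r addr0.
have termE i l : inner (P (u j i)) (Q (u k l)) =
    (expc t i)%:C%C * (expc t l)%:C%C * s (i + j)%N (l + k)%N.
  have PZ (c : R[i]) x : P (c *: x) = c *: P x by exact: linearZZ.
  have QZ (c : R[i]) x : Q (c *: x) = c *: Q x by exact: linearZZ.
  by rewrite /u PZ QZ innerZl innerZr conj_real mulrA.
have square : inner (P (X j m)) (Q (X k m)) = \sum_(i < m) \sum_(l < m)
     (expc t i)%:C%C * (expc t l)%:C%C * s (i + j)%N (l + k)%N.
  rewrite /X (linear_sum P) (linear_sum Q) inner_suml; apply: eq_bigr => i _.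
  by rewrite inner_sumr; apply: eq_bigr => l _; rewrite termE.
have Ph n : 0 <= (2^-1 : R) ^+ n <= 1.
  by rewrite exprn_ge0 ?invr_ge0//= exprn_ile1 ?invr_ge0// invf_le1// ler1n.
rewrite -triangle -(subrKA (inner (P (X j m)) (Q (X k m)))).
apply: le_trans (rnmD _ _) _; rewrite [leRHS]mulrDl lerD//; last first.
  rewrite square; apply: (square_triangle_error (F := fun i l =>
     (expc t i)%:C%C * (expc t l)%:C%C * s (i + j)%N (l + k)%N)) => i l.
  rewrite -termE; apply: le_trans (inner_le _ _) _.
  rewrite exprD mulrACA -!(mulrA _ (g _)) ler_pM ?rnm_ge0//.
    by apply: le_trans (Pp _) _; rewrite ler_wpM2l.
  by apply: le_trans (Qq _) _; rewrite ler_wpM2l.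
have Pw : rnm (P (w j) - P (X j m)) <= p * (2 * g j) * 2^-1 ^+ m.
  by rewrite -(linearB P) -mulrA; apply: le_trans (Pp _) _; rewrite ler_wpM2l.
have Qw : rnm (Q (w k) - Q (X k m)) <= q * (2 * g k) * 2^-1 ^+ m.
  by rewrite -(linearB Q) -mulrA; apply: le_trans (Qq _) _; rewrite ler_wpM2l.
have Xw : rnm (P (X j m)) <= p * (rnm (w j) + 2 * g j).
  apply: le_trans (Pp _) _; rewrite ler_wpM2l//.
  rewrite -[X j m](subrK (w j)) addrC; apply: le_trans (rnmD _ _) _.
  rewrite lerD2l -rnmN opprB; apply: le_trans (wX _ _) _.
  have /andP[_ h1] := Ph m; apply: ler_piMr h1.
  by apply: mulr_ge0 => //; exact: g_ge0.
apply: le_trans (inner_sub_le _ _ _ _) _.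
rewrite mulrDl lerD//.
  by rewrite mulrAC ler_pM ?rnm_ge0.
by rewrite -[leRHS]mulrA ler_pM ?rnm_ge0.
Qed.

End Step.

(** For the identities the linear term vanishes, so all norms are kept; the growth bound then holds
    for w with the same G and rho, and the next step has the same length. *)
Lemma flow_iter v (G rho : R) (N : nat) : 0 < rho -> 0 <= G ->
    (forall k, rnm (v k) <= G * k`!%:R * rho ^+ k) ->
    (forall j k, leibniz (form idfun idfun v) j k = 0) ->
  exists2 w, forall k, rnm (w k) = rnm (v k) &
   forall P Q, bounded_op P -> bounded_op Q ->
     (forall j k, leibniz (leibniz (form P Q v)) j k = 0) ->
   forall j k, form P Q w j k =
     form P Q v j k + (N%:R * (16 * rho)^-1)%:C%C * leibniz (form P Q v) j k.
Proof.
move=> rho0 G0 vG vD; elim: N => [|N [w wv wE]].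
  by exists v => // P Q _ _ _ j k; rewrite mul0r mul0r addr0.
have wG k : rnm (w k) <= G * k`!%:R * rho ^+ k by rewrite wv.
have leibnizE P Q : bounded_op P -> bounded_op Q ->
   (forall j k, leibniz (leibniz (form P Q v)) j k = 0) ->
   forall j k, leibniz (form P Q w) j k = leibniz (form P Q v) j k.
  (* The slope is constant along the flow, since its own image under [leibniz] is 0. *)
  move=> bP bQ D2 j k; rewrite {1}/leibniz !wE// addrACA -mulrDr.
  by have := D2 j k; rewrite {1}/leibniz => ->; rewrite mulr0 addr0.
have [w' w'E] := flow rho0 G0 wG.
have D2 P Q : bounded_op P -> bounded_op Q ->
   (forall j k, leibniz (leibniz (form P Q v)) j k = 0) ->
   forall j k, leibniz (leibniz (form P Q w)) j k = 0.
  by move=> bP bQ D2 j k; rewrite {1}/leibniz !leibnizE//; exact: D2.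
have vD2 j k : leibniz (leibniz (form idfun idfun v)) j k = 0.
  by rewrite {1}/leibniz !vD addr0.
exists w' => [k|P Q bP bQ vD2' j k].
  rewrite -wv; have := w'E _ _ bounded_op_id bounded_op_id
    (D2 _ _ bounded_op_id bounded_op_id vD2) k k.
  rewrite leibnizE ?vD ?mulr0 ?addr0//; try exact: bounded_op_id.
  rewrite /form/= !inner_rnm => /complexI /eqP.
  by rewrite eqrXn2 ?rnm_ge0// => /eqP.
rewrite w'E//; last exact: D2.
rewrite leibnizE// wE// -addrA -mulrDl -rmorphD /=.
by rewrite -[N.+1%:R]natr1 [in RHS]mulrDl mul1r.
Qed.

(** After N steps the form has moved by N times a fixed multiple of its slope, yet Cauchy-Schwarz
    and the preserved norm of v_0 bound it uniformly in N. *)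
Lemma leibniz_form_eq0 v (G rho : R) P Q : 0 < rho -> 0 <= G ->
    (forall k, rnm (v k) <= G * k`!%:R * rho ^+ k) ->
    (forall j k, leibniz (form idfun idfun v) j k = 0) ->
    bounded_op P -> bounded_op Q ->
    (forall j k, leibniz (leibniz (form P Q v)) j k = 0) ->
  leibniz (form P Q v) 0 0 = 0.
Proof.
move=> rho0 G0 vG vD bP bQ vD2.
have [p p0 Pp] := bounded_op_ge0 bP; have [q q0 Qq] := bounded_op_ge0 bQ.
apply/rnm0_eq0/eqP; rewrite eq_le rnm_ge0 andbT leNgt; apply/negP => d0.
set d := rnm _ in d0; set t := (16 * rho)^-1.
have t0 : 0 < t by rewrite invr_gt0 mulr_gt0.
(* Twice the bound on one value, because the displacement is a difference of two values. *)
pose K := 2 * (p * rnm (v 0) * (q * rnm (v 0))).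
have K0 : 0 <= K by rewrite !mulr_ge0 ?rnm_ge0.
have B w : rnm (w 0%N) = rnm (v 0%N) -> rnm (form P Q w 0 0) <= K / 2.
  move=> wv; rewrite /K mulrAC divff// mul1r -wv /form.
  by apply: le_trans (inner_le _ _) _; rewrite ler_pM ?rnm_ge0.
have NK (N : nat) : N%:R * t * d <= K.
  have [w wv wE] := flow_iter N rho0 G0 vG vD.
  have := wE _ _ bP bQ vD2 0%N 0%N => /eqP; rewrite addrC -subr_eq => /eqP e.
  have -> : N%:R * t * d =
     rnm ((N%:R * (16 * rho)^-1)%:C%C * leibniz (form P Q v) 0 0).
    by rewrite rnmM rnm_real ger0_norm// mulr_ge0// ltW.
  rewrite -e; apply: le_trans (rnmD _ _) _; rewrite rnmN.
  by rewrite [leRHS](splitr K) lerD ?B.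
have td : 0 < t * d by rewrite mulr_gt0.
have := archi_boundP (divr_ge0 K0 (ltW td)); rewrite ltNge => /negP; apply.
by rewrite ler_pdivlMr// mulrA.
Qed.

End Flow.

(** * Density and operator bounds with real constants *)

Section Approximation.
Context {R : realType}.

Lemma dense_approx (V : normedModType R[i]) (S : set V) : dense S ->
  forall (x : V) (e : R), 0 < e -> exists2 y, S y & rnm (x - y) < e.
Proof.
move=> dS x e e0; have e0' : 0 < e%:C%C :> R[i] by rewrite ltcR.
have [|y [xy Sy]] := dS (ball x e%:C%C) _ (ball_open x _).
  by exists x; exact: ballxx.
exists y => //; rewrite -ltcR -rnmE.
by move: xy; rewrite -ball_normE.
Qed.

Lemma continuous_bounded_op (H : hilbertType R) (P : {linear H -> H}) :
  continuous P -> bounded_op P.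
Proof.
move=> /(_ 0) /(continuous_linear_bounded 0) /linear_boundedP[M [Mreal MP]].
have M1 : M < M + 1 by rewrite ltrDl.
exists (rnm (M + 1)) => x; rewrite -lecR rmorphM /= -!rnmE.
apply: le_trans (MP _ M1 x) _.
by rewrite ler_wpM2r// real_ler_norm// realD// real1.
Qed.

End Approximation.

(** * Iterates of the derivation and growth of analytic vectors *)

Section Derivation.
Context {R : realType} {A : cstarAlgType R} (delta : star_derivation A).
Implicit Types a b c : A.

Lemma sder0 : delta 0 = 0.
Proof.
have := sder_lin 1 (sdom0 delta) (sdom0 delta).
rewrite !scale1r addr0 => /(congr1 (fun x => x - delta 0)).
by rewrite subrr addrK.
Qed.

Lemma iter_sder0 k : iter k delta 0 = 0.
Proof. by elim: k => // k IH; rewrite iterS IH sder0. Qed.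

(** The terms of a convergent series are bounded, which gives the estimate with rho the inverse of
    t. *)
Lemma analytic_growth b : analytic_vectors delta b ->
  exists G rho : R, [/\ 0 <= G, 0 < rho &
    forall k, rnm (iter k delta b) <= G * k`!%:R * rho ^+ k].
Proof.
move=> [_ [t t0 cv]].
have := cvg_series_cvg_0 cv => /cvgP /cvg_seq_bounded.
move=> /bounded_fun_has_ubound[G Gub].
exists `|G|, t^-1; split; rewrite ?invr_gt0// => k.
have tk : 0 < t ^+ k by rewrite exprn_gt0.
have fk : 0 < k`!%:R :> R by rewrite ltr0n fact_gt0.
have : t ^+ k / k`!%:R * rnm (iter k delta b) <= `|G|.
  by apply: le_trans (ler_norm G); apply: Gub; exists k.
rewrite mulrAC ler_pdivrMr// mulrC exprVn -ler_pdivlMr//.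
Qed.

End Derivation.

(** * Contractivity of a state *)

Section StateBound.
Context {R : realType} {A : cstarAlgType R} (omega : {scalar A}).
Hypothesis omega_state : is_state omega.

Lemma state_le (a : A) : rnm (omega a) <= rnm a.
Proof.
have unit_le (b : A) : `|b| <= 1 -> rnm (omega b) <= 1.
  by move=> b1; rewrite -lee_fin -(proj2 omega_state); apply: ereal_sup_ubound; exists b.
have [a0|an0] := eqVneq (rnm a) 0.
  by rewrite (rnm0_eq0 a0) linear0 !rnm0.
have agt0 : 0 < rnm a by rewrite lt_neqAle eq_sym an0 rnm_ge0.
have := unit_le ((rnm a)^-1%:C%C *: a).
have nE : rnm ((rnm a)^-1%:C%C : R[i]) = (rnm a)^-1.
  by rewrite rnm_real ger0_norm// invr_ge0 ltW.
rewrite rnmE lecR rnmZ nE mulVf// => /(_ (lexx _)).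
by rewrite linearZ /= rnmM nE ler_pdivrMl// mulr1.
Qed.

End StateBound.

(** * The derivation in the GNS representation *)

Section GNS.
Context {R : realType} {A : cstarAlgType R} {H : hilbertType R}.
Variables (omega : {scalar A}) (pi : star_rep A H) (f : H).
Hypothesis omega_state : is_state omega.
Hypothesis pi_GNS : is_GNS omega pi f.
Implicit Types a b c e x y : A.

Lemma inner_GNS x y : inner (pi x f) (pi y f) = omega (cmul (star y) x).
Proof. by rewrite (proj2 pi_GNS) rep_mul rep_star. Qed.

(** The square of the left side is omega of [cmul (star x) x], which [state_le] and the C*-identity
    bound by the square of the right side. *)
Lemma GNS_le x : rnm (pi x f) <= rnm x.
Proof.
rewrite -(@ler_pXn2r _ 2) ?nnegrE ?rnm_ge0//.
have -> : rnm (pi x f) ^+ 2 = rnm (omega (cmul (star x) x)).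
  by rewrite -inner_GNS inner_rnm rnm_real ger0_norm ?sqr_ge0.
apply: le_trans (state_le omega_state _) _.
by rewrite -lecR -rnmE norm_cstar rnmE rmorphXn.
Qed.

Lemma repD x y h : pi (x + y) h = pi x h + pi y h.
Proof. by have := rep_linear pi 1 x y h; rewrite !scale1r. Qed.

Lemma rep0 h : pi 0 h = 0.
Proof.
have := repD 0 0 h; rewrite addr0 => /(congr1 (fun z => z - pi 0 h)).
by rewrite subrr addrK.
Qed.

Lemma repB x y h : pi (x - y) h = pi x h - pi y h.
Proof. by rewrite -[in RHS](subrK y x) [in RHS]repD addrK. Qed.

Lemma rep_bounded a : bounded_op (pi a).
Proof. exact/continuous_bounded_op/rep_continuous. Qed.

(** By [GNS_le] the vectors pi b f with b in S are still dense in H, and pi e is bounded. *)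
Lemma rep_eq0_dense (S : set A) e : dense S ->
  (forall b, S b -> pi e (pi b f) = 0) -> forall h, pi e h = 0.
Proof.
move=> dS eS h; have [p p0 pe] := bounded_op_ge0 (rep_bounded e).
apply/rnm0_eq0/eqP; rewrite eq_le rnm_ge0 andbT; apply/ler_addgt0Pr => r r0.
(* Two approximations of size s are made, in H and in A; p + 1 replaces p, which may be 0. *)
rewrite add0r; pose s := r / (2 * (p + 1)).
have s0 : 0 < s by rewrite divr_gt0// mulr_gt0// ltr_wpDl.
have [_ [a _ <-] ha] := dense_approx (proj1 pi_GNS) h s0.
have [b Sb ab] := dense_approx dS a s0.
have hb : rnm (h - pi b f) <= s + s.
  rewrite -(subrKA (pi a f)); apply: le_trans (rnmD _ _) _.
  rewrite lerD ?(ltW ha)// -repB; apply: le_trans (GNS_le _) _; exact: ltW.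
have -> : pi e h = pi e (h - pi b f) by rewrite linearB /= eS// subr0.
apply: le_trans (pe _) _; apply: le_trans (ler_wpM2l p0 hb) _.
have p1 : p + 1 != 0 by rewrite gt_eqF// ltr_wpDl.
have -> : s + s = r / (p + 1) by rewrite /s; field.
by rewrite mulrCA ler_piMr ?(ltW r0)// ler_pdivrMr ?ltr_wpDl// mul1r lerDl.
Qed.

Variable delta : star_derivation A.
Hypothesis omega_delta : forall a, sdom delta a -> omega (delta a) = 0.

(** The sum is omega of the derivative of [cmul (star y) x]. *)
Lemma inner_sder x y : sdom delta x -> sdom delta y ->
  inner (pi (delta x) f) (pi y f) + inner (pi x f) (pi (delta y) f) = 0.
Proof.
move=> dx dy; have dsy := sdom_star dy.
rewrite !inner_GNS -sder_star// addrC -linearD -sder_mul//.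
exact/omega_delta/sdom_mul.
Qed.

Section Orbit.
Variable b : A.
Hypothesis b_dom : forall k, sdom delta (iter k delta b).

Let v k := pi (iter k delta b) f.

Lemma leibniz_form_id j k : leibniz (form idfun idfun v) j k = 0.
Proof. exact: (inner_sder (b_dom j) (b_dom k)). Qed.

(** This is [inner_sder] for the products of a and c with iterates of b: the product rule gives four
    terms, two of which form the left side. *)
Lemma leibniz_form_rep a c j k : sdom delta a -> sdom delta c ->
  leibniz (form (pi a) (pi c) v) j k =
  - (form (pi (delta a)) (pi c) v j k + form (pi a) (pi (delta c)) v j k).
Proof.
move=> da dc.
have dab := sdom_mul da (b_dom j); have dcb := sdom_mul dc (b_dom k).
have := inner_sder dab dcb.
rewrite !sder_mul// !repD !rep_mul innerDl innerDr addrACA => /eqP.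
by rewrite addrC addr_eq0 => /eqP.
Qed.

End Orbit.

Lemma rep_sder_analytic_eq0 a b : sdom delta a -> sdom delta (delta a) ->
  delta (delta a) = 0 -> analytic_vectors delta b ->
  pi (delta a) (pi b f) = 0.
Proof.
move=> da dda dda0 b_an.
have b_dom k : sdom delta (iter k delta b) by exact: (proj1 b_an k.+1).
have [G [rho [G0 rho0 bG]]] := analytic_growth b_an.
pose v k := pi (iter k delta b) f.
have vG k : rnm (v k) <= G * k`!%:R * rho ^+ k by exact: le_trans (GNS_le _) _.
have De j k : leibniz (form (pi (delta a)) (pi (delta a)) v) j k = 0.
  rewrite leibniz_form_rep// dda0 /form !rep0.
  by rewrite -(subrr (0 : H)) innerBl innerBr !subrr addr0 oppr0.
have Da j k : leibniz (form (pi a) (pi (delta a)) v) j k =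
    - form (pi (delta a)) (pi (delta a)) v j k.
  rewrite leibniz_form_rep// dda0 /form !rep0; congr (- _).
  by rewrite -(subrr (0 : H)) innerBr !subrr addr0.
(* At (0, 0) the slope is minus the square norm of [pi (delta a) (pi b f)]; that [leibniz] kills the
   form twice follows from [Da] and [De]. *)
have := leibniz_form_eq0 rho0 G0 vG (leibniz_form_id b_dom)
  (rep_bounded a) (rep_bounded (delta a)).
rewrite Da => /(_ _)/eqP; rewrite oppr_eq0 => e0.
apply/inner_eq0/eqP/e0 => j k.
by rewrite {1}/leibniz !Da -opprD; apply/eqP; rewrite oppr_eq0; apply/eqP/De.
Qed.

End GNS.

(** * Kernels of the powers of the derivation *)

Theorem mainTheorem2 (R : realType) (A : cstarAlgType R)
    (delta : star_derivation A) :
  (exists omega : {scalar A},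
     [/\ is_state omega,
         exists (H : hilbertType R) (pi : star_rep A H) (f : H),
           is_GNS omega pi f /\ faithful_rep pi
       & forall a : A, sdom delta a -> omega (delta a) = 0]) ->
  dense (analytic_vectors delta) ->
  forall n : nat, (1 <= n)%N -> ker_pow delta n = ker delta.
Proof.
move=> [omega [st [H [pi [f [gns faith]]]] od]] an_dense n n1.
have ker2 a : sdom delta a -> sdom delta (delta a) ->
    delta (delta a) = 0 -> delta a = 0.
  move=> da dda dda0; apply: faith => h; rewrite rep0.
  apply: (rep_eq0_dense st gns an_dense) => b b_an.
  exact: (rep_sder_analytic_eq0 st gns od).
rewrite predeqE => a; split=> [|[da da0]]; last first.
  split; last by case: n n1 => // n _; rewrite iterSr da0 iter_sder0.
  by case=> [|k] _ //; rewrite iterSr da0 iter_sder0; exact: sdom0.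
(* The exponent drops from n + 2 to n + 1 by applying [ker2] to the n-th iterate of a. *)
case: n n1 => // n _; elim: n => [[dom a0]|n IH [dom a0]].
  by split=> //; exact: (dom 0%N).
apply: IH; split=> [k kn|]; first by apply: dom; exact: ltnW.
by apply: ker2; [exact: (dom n)|exact: (dom n.+1)|].
Qed.
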